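(* Let $w=\log_2 7$ and let $A$ be any parallel version of Strassen's matrix multiplication algorithm (on $n\times n$ matrices) in the binary-forking model without atomics, which uses $s$ units of extra space. Then the span of $A$ is $\Omega(\max(n^w/s,\log n))$.
   Context: Binary-forking model without atomics: a computation starts with a single thread; any thread may fork a concurrent asynchronous child thread, recursively, and threads are synchronized by joins; the span is the length of the longest path in the resulting DAG, with no restriction on the number of processors. Every binary arithmetic operation (addition, subtraction, multiplication, division) writes its output to a memory location; concurrent reads of a memory location are allowed but concurrent writes to the same location are not. Extra space counts only memory allocated from the heap. A parallel version of Strassen's algorithm performs the $\Theta(n^w)$ arithmetic operations of Strassen's recursive algorithm (7 recursive half-size block products of linear combinations of input blocks, linearly combined into output blocks).
   Formalization: Inputs are read-only and each result location not counted in the s units is written at most once; overwritten storage counts as extra space. If the result matrix were free scratch, the n^w/s bound would fail for s=o(n^2). Matrices are zero-padded to a power of 2. *)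

(* Defs.v *)
From HB Require Import structures.
From mathcomp Require Import all_boot all_order all_algebra.
From mathcomp Require Import ring.

Set Implicit Arguments.
Unset Strict Implicit.
Unset Printing Implicit Defensive.

Import GRing.Theory.
Local Open Scope ring_scope.

(** * Computations in the binary-forking model *)

Variant arith := Add | Sub | Mul | Div.

Definition arith_op (F : fieldType) (o : arith) : F -> F -> F :=
  match o with
  | Add => fun x y => x + y
  | Sub => fun x y => x - y
  | Mul => fun x y => x * y
  | Div => fun x y => x / y
  end.

(* The writable memory locations of a computation on n x n matrices with s
   units of extra space: [inl (i, j)] is a location provided by the caller for
   entry (i, j) of the result, [inr k] is the k-th location allocated from the
   heap.  The locations of the two input matrices are read-only. *)
Definition cell (n s : nat) : finType := ('I_n * 'I_n + 'I_s)%type.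

Variant operand (F : fieldType) (n s : nat) :=
| Const of F
| InA of 'I_n & 'I_n
| InB of 'I_n & 'I_n
| Mem of cell n s.

(* The instructions of a computation with T threads.  [Local] is any step that
   does not access the shared memory, [Arith o x y c] writes the value of
   [x o y] to the location [c], [Fork t] starts thread t, and [Join t] waits
   for the end of thread t. *)
Variant instr (F : fieldType) (n s T : nat) :=
| Local
| Arith of arith & operand F n s & operand F n s & cell n s
| Fork of 'I_T
| Join of 'I_T.
Arguments Local {F n s T}.
Arguments Fork {F n s T}.
Arguments Join {F n s T}.

(* The computation starts with the single thread [ord0]. *)
Record computation (F : fieldType) (n s : nat) := Computation {
  other_threads : nat;
  code : 'I_other_threads.+1 -> seq (instr F n s other_threads.+1)
}.

Section Model.
Variables (F : fieldType) (n s : nat) (P : computation F n s).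

Definition thread : finType := 'I_(other_threads P).+1.

(* The vertex [Tagged _ i] with tag [t] is the i-th instruction of thread t. *)
Definition vertex : finType := {t : thread & 'I_(size (code t))}.

Definition instr_at (v : vertex) : instr F n s (other_threads P).+1 :=
  nth Local (code (tag v)) (tagged v).

Definition forks (v : vertex) (t : thread) : bool :=
  if instr_at v is Fork t' then t' == t else false.

Definition joins (v : vertex) (t : thread) : bool :=
  if instr_at v is Join t' then t' == t else false.

Definition writes (v : vertex) : option (cell n s) :=
  if instr_at v is Arith _ _ _ c then Some c else None.

(* Program order within a thread, from a fork to the first instruction of the
   child, and from the last instruction of a thread to its join. *)
Definition edge : rel vertex := fun u v =>
  [|| (tag u == tag v) && ((tagged u).+1 == tagged v),
      forks u (tag v) && (tagged v == 0%N :> nat)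
    | joins v (tag u) && ((tagged u).+1 == size (code (tag u)))].

Definition well_formed : Prop :=
  [/\ (forall t : thread, (0 < size (code t))%N),
      (forall t : thread, #|[set v | forks v t]| = (t != ord0)),
      (forall t : thread, (#|[set v | joins v t]| <= 1)%N)
    & (forall u v : vertex, edge u v -> ~~ connect edge v u)].

Definition no_concurrent_writes : Prop :=
  forall (u v : vertex) (c : cell n s),
    writes u = Some c -> writes v = Some c ->
    connect edge u v || connect edge v u.

(* The storage of the result is not extra space as long as it only receives the
   final results; storage that is overwritten in the course of the computation
   is working storage, and has to be allocated from the heap. *)
Definition output_written_once : Prop :=
  forall (u v : vertex) (i j : 'I_n),
    writes u = Some (inl (i, j)) -> writes v = Some (inl (i, j)) -> u = v.

(* The number of edges of a longest path. *)
Definition dag_span : nat :=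
  \max_(u : vertex)
    \max_(k < #|vertex| | [exists q : k.-tuple vertex, path edge u q]) k.

(** ** Asynchronous executions *)

(* Threads are asynchronous: the instructions may be executed in any order
   that is compatible with the DAG. *)
Definition schedule (sch : seq vertex) : Prop :=
  perm_eq sch (enum vertex) /\
  forall u v : vertex, edge u v -> (index u sch < index v sch)%N.

Definition eval (A B : 'M[F]_n) (h : cell n s -> F) (o : operand F n s) : F :=
  match o with
  | Const x => x
  | InA i j => A i j
  | InB i j => B i j
  | Mem c => h c
  end.

(* [D] is a set of vertices whose results are treated as unknowns: vertex
   [v \in D] writes [y v] instead of the result of its arithmetic operation. *)
Definition step (A B : 'M[F]_n) (D : pred vertex) (y : vertex -> F)
    (h : cell n s -> F) (v : vertex) : cell n s -> F :=
  if instr_at v is Arith o a b c then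
    [eta h with c |->
       if D v then y v else arith_op o (eval A B h a) (eval A B h b)]
  else h.

Definition run (A B : 'M[F]_n) (D : pred vertex) (y : vertex -> F)
    (h : cell n s -> F) (sch : seq vertex) : cell n s -> F :=
  foldl (step A B D y) h sch.

End Model.

(** * Strassen's algorithm *)

(* 2 ^ k, in a form for which matrices of size [pow2 k.+1] are convertible to
   2 x 2 block matrices with blocks of size [pow2 k]. *)
Fixpoint pow2 (k : nat) : nat := if k is k'.+1 then pow2 k' + pow2 k' else 1.

Section Strassen.
Variable F : fieldType.

Definition strassen_left m (i : 'I_7) (X : 'M[F]_(m + m)) : 'M[F]_m :=
  let X11 := ulsubmx X in let X12 := ursubmx X in
  let X21 := dlsubmx X in let X22 := drsubmx X in
  match val i with
  | 0 => X11 + X22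
  | 1 => X21 + X22
  | 2 => X11
  | 3 => X22
  | 4 => X11 + X12
  | 5 => X21 - X11
  | _ => X12 - X22
  end.

Definition strassen_right m (i : 'I_7) (Y : 'M[F]_(m + m)) : 'M[F]_m :=
  let Y11 := ulsubmx Y in let Y12 := ursubmx Y in
  let Y21 := dlsubmx Y in let Y22 := drsubmx Y in
  match val i with
  | 0 => Y11 + Y22
  | 1 => Y11
  | 2 => Y12 - Y22
  | 3 => Y21 - Y11
  | 4 => Y22
  | 5 => Y11 + Y12
  | _ => Y21 + Y22
  end.

Definition strassen_combine m (M : 'I_7 -> 'M[F]_m) : 'M[F]_(m + m) :=
  let M1 := M (inord 0) in let M2 := M (inord 1) in let M3 := M (inord 2) in
  let M4 := M (inord 3) in let M5 := M (inord 4) in let M6 := M (inord 5) in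
  let M7 := M (inord 6) in
  block_mx (M1 + M4 - M5 + M7) (M3 + M5)
           (M2 + M4)           (M1 - M2 + M3 + M6).

(* The leaves of the recursion tree of depth k are the k-tuples over 'I_7.
   [leaf_left X p] and [leaf_right Y p] are the two scalars multiplied at the
   leaf p when the matrices X and Y are multiplied. *)
Fixpoint leaf_left k : 'M[F]_(pow2 k) -> k.-tuple 'I_7 -> F :=
  match k with
  | 0 => fun X _ => X ord0 ord0
  | k'.+1 => fun X p =>
      @leaf_left k' (strassen_left (thead p) X) [tuple of behead p]
  end.

Fixpoint leaf_right k : 'M[F]_(pow2 k) -> k.-tuple 'I_7 -> F :=
  match k with
  | 0 => fun Y _ => Y ord0 ord0
  | k'.+1 => fun Y p =>
      @leaf_right k' (strassen_right (thead p) Y) [tuple of behead p]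
  end.

(* The output matrix as a function of the results x of the scalar products. *)
Fixpoint recombine k : (k.-tuple 'I_7 -> F) -> 'M[F]_(pow2 k) :=
  match k with
  | 0 => fun x => const_mx (x [tuple])
  | k'.+1 => fun x =>
      strassen_combine (fun i => @recombine k' (fun p => x [tuple of i :: p]))
  end.

(* Matrices of arbitrary size n are padded with zeros to the next power of 2. *)
Definition depth (n : nat) : nat := up_log 2 n.

Definition pad n (X : 'M[F]_n) : 'M[F]_(pow2 (depth n)) :=
  \matrix_(i, j) match insub (val i), insub (val j) with
                 | Some i', Some j' => X i' j'
                 | _, _ => 0
                 end.

Lemma leq_pow2_depth n : (n <= pow2 (depth n))%N.
Proof.
have -> k : pow2 k = (2 ^ k)%N.
  by elim: k => //= k ->; rewrite expnS mul2n addnn.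
exact: up_logP.
Qed.

Definition crop n (X : 'M[F]_(pow2 (depth n))) : 'M[F]_n :=
  \matrix_(i, j) X (widen_ord (leq_pow2_depth n) i)
                   (widen_ord (leq_pow2_depth n) j).

End Strassen.

(* The vertices [m p] carry out the scalar multiplications of Strassen's
   algorithm, and the final contents of the locations [res i j] is obtained
   from their results by Strassen's output combinations; the linear
   combinations may be evaluated by any arithmetic operations in any order, and
   further operations are allowed.  The requirement holds for all values [y] of
   the products, so that it constrains how the output is computed and not only
   that it equals the matrix product; actual executions are the case where [y]
   is the product of the operands. *)
Definition performs_strassen (F : fieldType) (n s : nat)
    (P : computation F n s) : Prop :=
  exists (m : (depth n).-tuple 'I_7 -> vertex P) (res : 'I_n -> 'I_n -> cell n s),
  forall (A B : 'M[F]_n) (y : vertex P -> F) (h : cell n s -> F)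
         (sch : seq (vertex P)),
    schedule sch ->
    let exec := run A B [in codom m] y h in
    (forall p, exists a b c,
       let before := exec (take (index (m p) sch) sch) in
       [/\ instr_at (m p) = Arith _ Mul a b c,
           eval A B before a = leaf_left (pad A) p
         & eval A B before b = leaf_right (pad B) p]) /\
    (forall i j, exec sch (res i j) = crop (recombine (y \o m)) i j).

Definition parallel_strassen (F : fieldType) (n s : nat)
    (P : computation F n s) : Prop :=
  [/\ well_formed P, no_concurrent_writes P, output_written_once P
    & performs_strassen P].

Lemma eq_recombine (F : fieldType) k (x x' : k.-tuple 'I_7 -> F) :
  x =1 x' -> recombine x = recombine x'.
Proof.
elim: k x x' => [|k IH] x x' e /=; first by rewrite e.
rewrite /strassen_combine.
by congr block_mx; do ?[congr (_ + _)]; do ?[congr (- _)]; apply: IH => p.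
Qed.

(* Sanity check: with the actual products, the recombined matrix is X *m Y. *)
Lemma recombine_correct (F : fieldType) k (X Y : 'M[F]_(pow2 k)) :
  recombine (fun p => leaf_left X p * leaf_right Y p) = X *m Y.
Proof.
elim: k X Y => [|k IH] X Y /=.
  by apply/matrixP=> i j; rewrite !mxE big_ord1 !ord1.
rewrite /strassen_combine.
have E i : recombine (fun p : k.-tuple 'I_7 =>
    leaf_left (strassen_left (thead [tuple of i :: p]) X)
      [tuple of behead [tuple of i :: p]] *
    leaf_right (strassen_right (thead [tuple of i :: p]) Y)
      [tuple of behead [tuple of i :: p]])
  = strassen_left i X *m strassen_right i Y.
  rewrite -IH; apply: eq_recombine => p; rewrite theadE.
  by have -> : [tuple of behead [tuple of i :: p]] = p by apply: val_inj.
rewrite !E /strassen_left /strassen_right /= !inordK //=.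
have -> : X *m Y = block_mx (ulsubmx X) (ursubmx X) (dlsubmx X) (drsubmx X) *m
    block_mx (ulsubmx Y) (ursubmx Y) (dlsubmx Y) (drsubmx Y) by rewrite !submxK.
rewrite mulmx_block.
rewrite !(mulmxDl, mulmxDr, mulNmx, mulmxN).
congr block_mx; repeat match goal with
  | |- context [@mulmx ?R ?a ?b ?c ?U ?V] => move: (@mulmx R a b c U V) => ?
  end; apply/matrixP => i j; rewrite !mxE; ring.
Qed.

Lemma crop_pad_mul (F : fieldType) n (A B : 'M[F]_n) :
  crop (pad A *m pad B) = A *m B.
Proof.
apply/matrixP => i j; rewrite !mxE.
have padE (X : 'M[F]_n) (a b : 'I_n) (a' b' : 'I_(pow2 (depth n))) :
    a = a' :> nat -> b = b' :> nat -> pad X a' b' = X a b.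
  move=> ea eb; rewrite mxE.
  by rewrite /= -ea -eb !valK.
have pad0 (X : 'M[F]_n) a' (b' : 'I_(pow2 (depth n))) :
    ~~ (b' < n)%N -> pad X a' b' = 0.
  by move=> nb; rewrite mxE [insub (val b')]insubF ?(negPf nb) //; case: (insub _).
rewrite (bigID (fun k : 'I__ => (k < n)%N)) /= addrC big1 ?add0r; last first.
  by move=> k nk; rewrite pad0 // mul0r.
rewrite (big_ord_narrow (leq_pow2_depth n)).
by apply: eq_bigr => k _; congr (_ * _); apply: padE.
Qed.

(* Sanity check: every execution of a computation that performs Strassen's
   algorithm leaves the product of the inputs in the output locations. *)
Lemma performs_strassen_correct (F : fieldType) (n s : nat)
    (P : computation F n s) :
  performs_strassen P ->
  exists res : 'I_n -> 'I_n -> cell n s,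
    forall (A B : 'M[F]_n) (h : cell n s -> F) (sch : seq (vertex P)),
      schedule sch ->
      forall i j, run A B pred0 (fun=> 0) h sch (res i j) = (A *m B) i j.
Proof.
case=> m [res ms]; exists res => A B h sch schP i j.
pose y v := let h' := run A B pred0 (fun=> 0) h (take (index v sch) sch) in
  if instr_at v is Arith o a b c then arith_op o (eval A B h' a) (eval A B h' b)
  else 0.
have sch_uniq : uniq sch by rewrite (perm_uniq schP.1) enum_uniq.
have runE k : run A B [in codom m] y h (take k sch)
    = run A B pred0 (fun=> 0) h (take k sch).
  elim: k => [|k IH]; first by rewrite take0.
  have [ltk|lek] := ltnP k (size sch); last first.
    by rewrite !take_oversize ?(leqW lek) // in IH *.
  case: sch ltk {schP} @y sch_uniq IH => // v0 sch' ltk y sch_uniq IH.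
  rewrite (take_nth v0) // /run -cats1 !foldl_cat /= -!/(run _ _ _ _ _ _) IH.
  rewrite /step /y index_uniq //; case: (instr_at _) => // o a b c.
  by case: ifP.
have [opsE outE] := ms A B y h sch schP.
have := outE i j; have := runE (size sch); rewrite take_size => -> ->.
have yE p : (y \o m) p = leaf_left (pad A) p * leaf_right (pad B) p.
  have [a [b [c [im <- <-]]]] := opsE p.
  by rewrite /= /y im /= !runE.
by rewrite (eq_recombine yE) recombine_correct crop_pad_mul.
Qed.

(* Main.v *)
Require Import Defs.
From mathcomp Require Import all_boot all_order all_algebra.
From mathcomp Require Import all_classical all_reals all_analysis.
From mathcomp Require Import zify.
Import Order.TTheory GRing.Theory Num.Theory numFieldNormedType.Exports.

(** Let d = ceil(log2 n) and let L be the span.  The leaves of the recursion tree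
  below the block product with left factor X11 are 7 ^ (d-1) scalar products
  whose left operands are pairwise different linear forms, also after padding,
  so at least 7 ^ (d-1) vertices write to memory.  An output location is written
  at most once.  The writes to any other location are pairwise connected in the
  DAG, hence lie on one path and number at most L + 1.  Thus 7 ^ (d-1) <=
  n ^ 2 + s (L + 1), and n ^ 2 is negligible since 4 < 7.  On the other hand
  every vertex is reached from the first instruction by at most L edges and
  vertices have bounded outdegree, so 7 ^ (d-1) <= 4 ^ L. *)

Set Implicit Arguments.
Unset Strict Implicit.
Unset Printing Implicit Defensive.

(** * Chains and reachability in finite acyclic graphs *)

Definition acyclic (T : finType) (e : rel T) : Prop :=
  forall u v, e u v -> ~~ connect e v u.

(** Serves as a topological rank: in an acyclic graph it strictly increases along edges. *)
Definition ancestors (T : finType) (e : rel T) (v : T) : nat :=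
  #|[pred u | connect e u v]|.

Lemma acyclic_ancestors_edge (T : finType) (e : rel T) u v :
  acyclic e -> e u v -> ancestors e u < ancestors e v.
Proof.
move=> ace euv; apply: proper_card; apply/properP; split.
  apply/fintype.subsetP => x; rewrite !inE => xu.
  exact: connect_trans xu (connect1 euv).
by exists v; rewrite !inE ?connect0 // ace.
Qed.

Lemma acyclic_path_ancestors (T : finType) (e : rel T) u q :
  acyclic e -> path e u q -> path (relpre (ancestors e) ltn) u q.
Proof. by move=> ace; apply: sub_path => x y; apply: acyclic_ancestors_edge. Qed.

Lemma acyclic_path_uniq (T : finType) (e : rel T) u q :
  acyclic e -> path e u q -> uniq (u :: q).
Proof.
move=> ace /(acyclic_path_ancestors ace) uq.
have tr : transitive (relpre (ancestors e) ltn) by move=> y x z; apply: ltn_trans.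
by apply: (sorted_uniq tr _ (s := u :: q)) => // x; apply: ltnn.
Qed.

Lemma acyclic_path_size (T : finType) (e : rel T) u q :
  acyclic e -> path e u q -> size q < #|T|.
Proof.
by move=> ace /(acyclic_path_uniq ace)/card_uniqP /= <-; apply: max_card.
Qed.

Lemma acyclic_ancestors (T : finType) (e : rel T) u v :
  acyclic e -> connect e u v -> u != v -> ancestors e u < ancestors e v.
Proof.
move=> ace /connectP[[|x q] uq ->]; first by rewrite eqxx.
move=> _; have /(acyclic_path_ancestors ace) := uq.
rewrite path_sortedE => [/andP[/allP]|y a z /=]; last exact: ltn_trans.
by move=> + _; apply => /=; rewrite mem_last.
Qed.

Lemma connect_path_refine (T : finType) (e : rel T) x s :
  path (connect e) x s -> uniq (x :: s) ->
  exists2 q, path e x q & size s <= size q.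
Proof.
elim: s x => [|y s IH] x; first by exists [::].
case/andP=> /connectP[p xp yE] ys /andP[xs us].
have [q yq sq] := IH y ys us; exists (p ++ q).
  by rewrite cat_path xp -yE.
rewrite size_cat /= -add1n leq_add // lt0n size_eq0; apply/eqP => p0.
by move: xs; rewrite yE p0 mem_head.
Qed.

Lemma card_chain (T : finType) (e : rel T) (L : nat) (A : {pred T}) :
  acyclic e -> (forall u q, path e u q -> size q <= L) ->
  {in A &, forall u v, connect e u v || connect e v u} -> #|A| <= L.+1.
Proof.
move=> ace leL chainA.
pose le_anc := relpre (ancestors e) leq.
have tot : total le_anc by move=> x y; apply: leq_total.
have tr : transitive le_anc by move=> y x z; apply: leq_trans.
pose s := sort le_anc (enum A).
have us : uniq s by rewrite sort_uniq enum_uniq.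
have As : all [in A] s by apply/allP => x; rewrite mem_sort mem_enum.
have : sorted le_anc s by apply: sort_sorted.
rewrite cardE -(size_sort le_anc) -/s.
case: s us As => // x s us As sx; rewrite ltnS.
suff xs : path (connect e) x s.
  by have [q /leL + sq] := connect_path_refine xs us; apply: leq_trans.
apply: sub_in_path As sx => y z yA zA.
(* If [z] were not reachable from [y], then [z] would reach [y] and have strictly fewer ancestors,
   against the sorting. *)
rewrite /le_anc /=; apply: contraTT => nyz; rewrite -ltnNge.
have := chainA y z yA zA; rewrite (negPf nyz) /= => zy.
apply: acyclic_ancestors => //; apply: contraNneq nyz => ->; exact: connect0.
Qed.

(** Enlarging a ball around [r] by one step multiplies its size by at most [D.+1], and the ball of
    radius [L] is everything. *)
Lemma card_reachable (T : finType) (e : rel T) (r : T) (D L : nat) :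
  (forall u, #|e u| <= D) -> (forall u q, path e u q -> size q <= L) ->
  (forall v, connect e r v) -> #|T| <= D.+1 ^ L.
Proof.
move=> leD leL rT.
pose grow (B : {set T}) := B :|: \bigcup_(u in B) [set v in e u].
pose ball k := iter k grow [set r].
have ballS : {homo ball : j k / j <= k >-> j \subset k}.
  apply: homo_leq => [B||k]; rewrite ?subxx //.
    by move=> ? ? ?; apply: fintype.subset_trans.
  exact: finset.subsetUl.
have card_ball k : #|ball k| <= D.+1 ^ k.
  elim: k => [|k IH]; first by rewrite cards1.
  rewrite expnS mulSn (leq_trans (leq_card_setU _ _)) // leq_add //.
  apply: leq_trans (leq_mul (leqnn D) IH); rewrite mulnC -sum_nat_const.
  apply: (@leq_trans (\sum_(u in ball k) #|e u|)); last exact: leq_sum.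
  rewrite -/(ball k); elim/big_rec2: _ => [|u m B _ leB]; first by rewrite cards0.
  by rewrite (leq_trans (leq_card_setU _ _)) // leq_add // cardsE.
have path_ball q : path e r q -> last r q \in ball (size q).
  elim/last_ind: q => [|q x IH]; first by rewrite inE.
  rewrite rcons_path last_rcons size_rcons => /andP[/IH rq ex].
  rewrite inE; apply/orP; right; apply/finset.bigcupP.
  by exists (last r q); rewrite ?inE.
apply: leq_trans (card_ball L); apply/subset_leq_card/fintype.subsetP => v _.
have /connectP[q rq ->] := rT v.
by apply: (fintype.subsetP (ballS _ _ (leL _ _ rq))); apply: path_ball.
Qed.

(** * The computation DAG: schedules, degrees and writes *)

(** [performs_strassen] speaks only of executions along a schedule; sorting by ancestor count
    provides one. *)
Lemma schedule_exists (F : fieldType) (n s : nat) (P : computation F n s) :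
  well_formed P -> exists sch : seq (vertex P), schedule sch.
Proof.
case=> _ _ _ ace.
pose le_anc := relpre (ancestors (@edge _ _ _ P)) leq.
have tot : total le_anc by move=> x y; apply: leq_total.
exists (sort le_anc (enum (vertex P))); split.
  by rewrite perm_sort.
move=> u v uv; rewrite ltnNge; apply/negP => vu.
have tr : transitive le_anc by move=> y x z; apply: leq_trans.
have := acyclic_ancestors_edge ace uv; rewrite ltnNge.
have le_refl : reflexive le_anc by move=> x; apply: leqnn.
have := sorted_leq_index tr le_refl (sort_sorted tot (enum (vertex P))).
by move=> /(_ v u); rewrite !mem_sort !mem_enum => /(_ isT isT vu) /= ->.
Qed.

(** The maximum in [dag_span] ranges over lengths below [#|vertex P|]; acyclicity keeps every path
    in that range. *)
Lemma path_size_dag_span (F : fieldType) (n s : nat) (P : computation F n s) u q :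
  well_formed P -> path (@edge _ _ _ P) u q -> size q <= dag_span P.
Proof.
case=> _ _ _ ace uq; have ltq := acyclic_path_size ace uq.
apply: leq_trans (leq_bigmax u).
rewrite (@leq_bigmax_cond _ _ (fun k : 'I__ => val k) (Ordinal ltq)) //.
by apply/existsP; exists (in_tuple q).
Qed.

Lemma vertex_eq (F : fieldType) (n s : nat) (P : computation F n s)
    (u v : vertex P) :
  tag u = tag v -> tagged u = tagged v :> nat -> u = v.
Proof.
by case: u v => [t i] [t' j] /= tE; case: t' / tE j => j /val_inj ->.
Qed.

(** A successor is the next instruction, the start of the forked child, or the join of the own
    thread; there is at most one of each. *)
Lemma edge_outdegree (F : fieldType) (n s : nat) (P : computation F n s) u :
  well_formed P -> #|@edge _ _ _ P u| <= 3.
Proof.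
case=> _ _ join1 _.
pose next := [pred v : vertex P | (tag u == tag v) && ((tagged u).+1 == tagged v)].
pose child := [pred v : vertex P | forks u (tag v) && (tagged v == 0 :> nat)].
pose joiner := [pred v : vertex P | joins v (tag u)].
have next1 : #|next| <= 1.
  apply/card_le1_eqP => v v'; rewrite !inE.
  case/andP=> /eqP t /eqP i /andP[/eqP t' /eqP i'].
  by apply: vertex_eq; rewrite -?t -?i.
have child1 : #|child| <= 1.
  apply/card_le1_eqP => v v'; rewrite !inE /forks; case: (instr_at u) => // t.
  case/andP=> /eqP tv /eqP i /andP[/eqP tv' /eqP i'].
  by apply: vertex_eq; rewrite -?tv // i i'.
have joiner1 : #|joiner| <= 1 by have := join1 (tag u); rewrite cardsE.
apply: leq_trans (_ : #|predU next (predU child joiner)| <= _).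
  apply/subset_leq_card/fintype.subsetP => v; rewrite !inE.
  case/or3P=> [->//|->|/andP[->]].
    by rewrite orbT.
  by rewrite !orbT.
have leU (A B : {pred vertex P}) : #|[predU A & B]| <= #|A| + #|B|.
  by rewrite -cardUI leq_addr.
apply: leq_trans (leU _ _) (leq_add next1 _).
exact: leq_trans (leU _ _) (leq_add child1 joiner1).
Qed.

(** Induction on the ancestor count: a vertex other than the start of [ord0] is preceded by an
    instruction of its thread or by the fork of its thread. *)
Lemma root_connect (F : fieldType) (n s : nat) (P : computation F n s) :
  well_formed P -> exists r : vertex P, forall v, connect (@edge _ _ _ P) r v.
Proof.
case=> size_gt0 fork1 _ ace.
pose vtx (t : thread P) (i : 'I_(size (Defs.code t))) : vertex P := Tagged _ i.
pose r := vtx ord0 (Ordinal (size_gt0 ord0)).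
exists r => v.
elim: {v}(ancestors _ v).+1 {-2}v (ltnSn (ancestors (@edge _ _ _ P) v)) => //.
move=> k IH v; rewrite ltnS => lek.
have step u : edge u v -> connect (@edge _ _ _ P) r v.
  move=> uv; apply: connect_trans (connect1 uv); apply: IH.
  exact: leq_trans (acyclic_ancestors_edge ace uv) lek.
case: v lek step => t [[|i] lti] lek step; last first.
  by apply: (step (vtx t (Ordinal (ltnW lti)))); rewrite /edge /= !eqxx.
have [t0|tN0] := eqVneq t ord0.
  by rewrite (_ : existT _ _ _ = r) ?connect0 //; apply: vertex_eq.
have : 0 < #|[set v | forks v t]| by rewrite fork1 tN0.
case/card_gt0P => u; rewrite inE => ut; apply: (step u).
by rewrite /edge /= ut orbT.
Qed.

Lemma card_vertex_leq (F : fieldType) (n s : nat) (P : computation F n s) :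
  well_formed P -> #|vertex P| <= 4 ^ dag_span P.
Proof.
move=> wf; have [r rT] := root_connect wf.
apply: card_reachable rT => [u|u q]; first exact: edge_outdegree.
exact: path_size_dag_span.
Qed.

Lemma card_writes_leq (F : fieldType) (n s : nat) (P : computation F n s) :
  well_formed P -> no_concurrent_writes P -> output_written_once P ->
  #|[pred v : vertex P | writes v != None]| <= n ^ 2 + s * (dag_span P).+1.
Proof.
move=> wf seqw once.
have -> : n ^ 2 + s * (dag_span P).+1 =
    \sum_(ij : 'I_n * 'I_n) 1 + \sum_(k < s) (dag_span P).+1.
  by rewrite !sum_nat_const card_prod !card_ord muln1 mulnn.
apply: (@leq_trans
  (\sum_(c : cell n s) #|[pred v : vertex P | writes v == Some c]|)).
  (* Double counting: each writing vertex is counted at the cell it writes. *)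
  under eq_bigr do rewrite -sum1_card big_mkcond /=.
  rewrite exchange_big -sum1_card big_mkcond /=; apply: leq_sum => v _.
  rewrite inE; case wv: (writes v) => [c|] //=.
  by rewrite (bigD1 c) //= inE wv eqxx.
rewrite big_sumType /=; apply: leq_add; apply: leq_sum => c _.
  apply/card_le1_eqP => v u; rewrite !inE => /eqP vc /eqP uc.
  by case: c vc uc => i j vc uc; apply: once uc vc.
have [_ _ _ ace] := wf.
apply: (card_chain ace) => [u q|u v]; first exact: path_size_dag_span.
by rewrite !inE => /eqP uc /eqP vc; apply: seqw uc vc.
Qed.

Local Open Scope ring_scope.

(** * Separating the left operands of the leaves *)

(** Test input isolating one quadrant; [t] is its (row, column) position, with [true] for the second
    half. *)
Definition block_at (F : fieldType) m (t : bool * bool) (Z : 'M[F]_m) :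
    'M[F]_(m + m) :=
  let Zat u := if t == u then Z else 0 in
  block_mx (Zat (false, false)) (Zat (false, true))
           (Zat (true, false)) (Zat (true, true)).

Definition left_coef (F : fieldType) (i : 'I_7) (t : bool * bool) : F :=
  match val i, t with
  | 0, (false, false) | 0, (true, true) => 1
  | 1, (true, _) => 1
  | 2, (false, false) => 1
  | 3, (true, true) => 1
  | 4, (false, _) => 1
  | 5, (true, false) => 1
  | 5, (false, false) => -1
  | 6, (false, true) => 1
  | 6, (true, true) => -1
  | _, _ => 0
  end.

Lemma strassen_left_block_at (F : fieldType) m i t (Z : 'M[F]_m) :
  strassen_left i (block_at t Z) = left_coef F i t *: Z.
Proof.
rewrite /strassen_left /left_coef /block_at.
rewrite block_mxKul block_mxKur block_mxKdl block_mxKdr.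
case: i => [[|[|[|[|[|[|[|i]]]]]]] lti] //=; case: t => [[] []] /=;
  by rewrite ?(scale0r, scale1r, scaleN1r, addr0, add0r, subr0, sub0r, oppr0).
Qed.

(* The seven left factors involve pairwise different sets of blocks. *)
Lemma left_coef_neq (F : fieldType) (i j : 'I_7) :
  i != j -> exists t, (left_coef F i t == 0) != (left_coef F j t == 0).
Proof.
rewrite /left_coef.
case: i => [[|[|[|[|[|[|[|i]]]]]]] lti] //;
  case: j => [[|[|[|[|[|[|[|j]]]]]]] ltj] //= _;
  solve [ exists (false, false); rewrite /= ?(oppr_eq0, oner_eq0, eqxx) //
    | exists (false, true); rewrite /= ?(oppr_eq0, oner_eq0, eqxx) //
    | exists (true, false); rewrite /= ?(oppr_eq0, oner_eq0, eqxx) //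
    | exists (true, true); rewrite /= ?(oppr_eq0, oner_eq0, eqxx) // ].
Qed.

Lemma left_coef_neq0 (F : fieldType) (i : 'I_7) :
  exists t, left_coef F i t != 0.
Proof.
rewrite /left_coef.
case: i => [[|[|[|[|[|[|[|i]]]]]]] lti] //;
  solve [ exists (false, false); rewrite /= ?(oppr_eq0, oner_eq0, eqxx) //
    | exists (false, true); rewrite /= ?(oppr_eq0, oner_eq0, eqxx) //
    | exists (true, false); rewrite /= ?(oppr_eq0, oner_eq0, eqxx) //
    | exists (true, true); rewrite /= ?(oppr_eq0, oner_eq0, eqxx) // ].
Qed.

Lemma strassen_leftZ (F : fieldType) m i (c : F) (X : 'M[F]_(m + m)) :
  strassen_left i (c *: X) = c *: strassen_left i X.
Proof.
rewrite /strassen_left; apply/matrixP => a b.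
by case: (val i) => [|[|[|[|[|[|k]]]]]]; rewrite !mxE ?mulrDr ?mulrN.
Qed.

Lemma leaf_leftZ (F : fieldType) k (c : F) (X : 'M[F]_(pow2 k)) p :
  leaf_left (c *: X) p = c * leaf_left X p.
Proof.
elim: k X p => [|k IH] X p /=; first by rewrite mxE.
by rewrite strassen_leftZ IH.
Qed.

Lemma leaf_left_block_at (F : fieldType) k t (Z : 'M[F]_(pow2 k)) p :
  @leaf_left F k.+1 (block_at t Z) p =
  left_coef F (thead p) t * leaf_left Z [tuple of behead p].
Proof. by rewrite /= strassen_left_block_at leaf_leftZ. Qed.

Lemma leaf_left_neq0 (F : fieldType) k p :
  exists X : 'M[F]_(pow2 k), leaf_left X p != 0.
Proof.
elim: k p => [|k IH] p; first by exists (const_mx 1); rewrite /= mxE oner_eq0.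
have [t nt] := left_coef_neq0 F (thead p); have [Z nZ] := IH [tuple of behead p].
by exists (block_at t Z); rewrite leaf_left_block_at mulf_neq0.
Qed.

(** Equal heads: a quadrant with nonzero coefficient transmits an input separating the tails.
    Different heads: on a quadrant where exactly one coefficient vanishes, one leaf is 0 and the
    other can be made nonzero, whatever the tails are. *)
Lemma leaf_left_neq (F : fieldType) k (p q : k.-tuple 'I_7) :
  p != q -> exists X : 'M[F]_(pow2 k), leaf_left X p != leaf_left X q.
Proof.
elim: k p q => [|k IH] p q; first by rewrite (tuple0 p) (tuple0 q) eqxx.
have [hpq|hpq] := eqVneq (thead p) (thead q) => npq.
  have [|Z nZ] := IH [tuple of behead p] [tuple of behead q].
    apply: contra npq => /eqP/(congr1 val) /= tpq; apply/eqP/val_inj.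
    by rewrite /= (tuple_eta p) (tuple_eta q) /= hpq tpq.
  have [t nt] := left_coef_neq0 F (thead p).
  exists (block_at t Z); rewrite !leaf_left_block_at -hpq.
  by apply: contra nZ => /eqP/(mulfI nt) ->.
have [t] := left_coef_neq F hpq.
case: (eqVneq _ 0) => p0; case: (eqVneq _ 0) => q0 // _.
  have [Z nZ] := leaf_left_neq0 F [tuple of behead q]; exists (block_at t Z).
  by rewrite !leaf_left_block_at p0 mul0r eq_sym mulf_neq0.
have [Z nZ] := leaf_left_neq0 F [tuple of behead p]; exists (block_at t Z).
by rewrite !leaf_left_block_at q0 mul0r mulf_neq0.
Qed.

Lemma pow2E k : pow2 k = (2 ^ k)%N.
Proof. by elim: k => //= k ->; rewrite expnS mul2n addnn. Qed.

(** The matrix is [pad A] written out at size [pow2 k.+1], so that it matches after rewriting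
    [depth n]. Its upper left quadrant contains no padding. *)
Lemma pad_ulsubmx (F : fieldType) n k (X : 'M[F]_(pow2 k)) :
  (pow2 k <= n)%N -> exists A : 'M[F]_n,
  ulsubmx (\matrix_(i < pow2 k.+1, j < pow2 k.+1)
             match insub (val i), insub (val j) with
             | Some i', Some j' => A i' j'
             | _, _ => 0
             end) = X.
Proof.
move=> le_n.
exists (\matrix_(i, j) match insub (val i), insub (val j) with
                       | Some i', Some j' => X i' j'
                       | _, _ => 0
                       end).
apply/matrixP => i j; rewrite !mxE /=.
have lt_n (a : 'I_(pow2 k)) : (a < n)%N := leq_trans (ltn_ord a) le_n.
rewrite (insubT (fun a => (a < n)%N) (lt_n i)).
by rewrite (insubT (fun a => (a < n)%N) (lt_n j)) mxE /= !valK.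
Qed.

Lemma leaf_left_pad_neq (F : fieldType) n k :
  depth n = k.+1 -> exists f : k.-tuple 'I_7 -> (depth n).-tuple 'I_7,
  forall p q, p != q ->
    exists A : 'M[F]_n, leaf_left (pad A) (f p) != leaf_left (pad A) (f q).
Proof.
move=> dn.
(* [k.+1] is the least exponent whose power of 2 reaches [n]. *)
have le_n : (pow2 k <= n)%N.
  rewrite pow2E ltnW // (_ : k = (up_log 2 n).-1); last by rewrite -/(depth n) dn.
  by rewrite up_log_gtn //; case: n dn => [|[]].
rewrite /pad dn => {dn}.
(* The left factor of index 2 is X11, the only block that padding leaves intact. *)
exists (fun p : k.-tuple 'I_7 => [tuple of inord 2 :: p]) => p q npq.
have [X nX] := leaf_left_neq F npq; have [A AX] := pad_ulsubmx X le_n.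
have left2 (Y : 'M[F]_(pow2 k + pow2 k)) : strassen_left (inord 2) Y = ulsubmx Y.
  by rewrite /strassen_left /= inordK.
exists A; rewrite /= !theadE !left2 AX.
have tupleK (r : k.-tuple 'I_7) (i : 'I_7) :
  [tuple of behead [tuple of i :: r]] = r by apply: val_inj.
by rewrite !tupleK.
Qed.

(** * Lower bounds on the number of writes and on the span *)

Lemma card_writes_geq (F : fieldType) (n s k : nat) (P : computation F n s) :
  well_formed P -> performs_strassen P -> depth n = k.+1 ->
  (7 ^ k <= #|[pred v : vertex P | writes v != None]|)%N.
Proof.
move=> wf [m [res ms]] dn.
have [sch schP] := schedule_exists wf.
have [f f_neq] := leaf_left_pad_neq F dn.
(* Leaves sharing a vertex would read the same operand in the same memory state, hence have equal
   left operands for every [A]. *)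
have mf_inj : injective (m \o f).
  move=> p q /= mpq; apply/eqP; apply: contraT => /f_neq[A].
  have [opsE _] := ms A 0 (fun=> 0) (fun=> 0) sch schP.
  have [a [b [c [ip <- _]]]] := opsE (f p).
  have [a' [b' [c' [iq <- _]]]] := opsE (f q).
  by move: iq; rewrite -mpq ip => -[<- _ _]; rewrite eqxx.
rewrite -[X in (X ^ _)%N](card_ord 7) -card_tuple -(card_codom mf_inj).
apply/subset_leq_card/fintype.subsetP => _ /codomP[p ->].
have [opsE _] := ms 0 0 (fun=> 0) (fun=> 0) sch schP.
by have [a [b [c [ip _ _]]]] := opsE (f p); rewrite inE /writes /= ip.
Qed.

Lemma span_bounds (F : fieldType) (n s : nat) (P : computation F n s) :
  (16 < n)%N -> parallel_strassen P ->
  [/\ (0 < dag_span P)%N, (7 ^ depth n <= 28 * (s * dag_span P))%N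
    & (depth n <= 2 * dag_span P)%N].
Proof.
move=> n_gt16 [wf seqw once perf].
have d_gt4 : (4 < depth n)%N.
  rewrite ltnNge; apply/negP => le4.
  have := up_logP n (isT : (1 < 2)%N); rewrite -/(depth n) leqNgt => /negP; apply.
  by apply: leq_ltn_trans n_gt16; rewrite (leq_exp2l _ 4).
case dn : (depth n) d_gt4 => [//|k]; rewrite ltnS => k_ge4.
have leaves := card_writes_geq wf perf dn.
(* Outdegree 3 gives [4 ^ k <= 7 ^ k <= #|vertex P| <= 4 ^ dag_span P]. *)
have k_le : (k <= dag_span P)%N.
  rewrite -(@leq_exp2l 4) // (leq_trans _ (card_vertex_leq wf)) //.
  apply: leq_trans (leq_trans leaves (max_card _)).
  by rewrite leq_exp2r // (leq_trans _ k_ge4).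
have L_gt0 : (0 < dag_span P)%N := leq_trans (leq_trans (isT : 0 < 4)%N k_ge4) k_le.
split=> //; last by rewrite mul2n -addnn -addn1 leq_add.
(* The threshold 16 comes from here: the induction starts at exponent 5, where 14 * 4 ^ 5 = 14336 <=
   16807 = 7 ^ 5. *)
have n2_small : (14 * n ^ 2 <= 7 ^ k.+1)%N.
  have n_le : (n <= 2 ^ k.+1)%N by rewrite -dn up_logP.
  apply: (@leq_trans (14 * 4 ^ k.+1)).
    by rewrite leq_mul2l /= (_ : 4 = 2 ^ 2)%N // -expnM mulnC expnM leq_exp2r.
  rewrite -(subnKC k_ge4) -addSn; elim: (k - 4)%N => [|j IH]; first by [].
  by rewrite addnS (expnS 4) (expnS 7) mulnCA leq_mul.
(* With L the span, [n ^ 2] is at most half of [7 ^ k] and s (L + 1) <= 2 s L, so [7 ^ k] is at most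
   4 s L; one more factor 7 gives 28. *)
have := leq_trans leaves (card_writes_leq wf seqw once).
have : (s <= s * dag_span P)%N by rewrite leq_pmulr.
by move: n2_small; rewrite (expnS 7) mulnS; lia.
Qed.

(** * The asymptotic statement over the reals *)

Local Open Scope classical_set_scope.
Local Open Scope ring_scope.

Theorem theorem5 (R : realType) (F : fieldType) (s : nat -> nat)
    (A : forall n : nat, computation F n (s n))
    (hA : forall n : nat, (0 < n)%N -> parallel_strassen (A n)) :
  let w : R := ln 7 / ln 2 in
  (fun n : nat => (dag_span (A n))%:R : R^o) \is
    'Omega_\oo (fun n : nat =>
      Num.max (n%:R `^ w / (s n)%:R) (ln n%:R / ln 2) : R^o).
Proof.
rewrite /= qualifE; set w := ln 7 / ln 2; apply/asboolP.
(* The constant of [span_bounds]; it also covers the factor 2 of the logarithmic bound. *)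
exists 28^-1; first by rewrite invr_gt0.
exists 17%N => // n /= n_gt16.
have n_gt0 : (0 < n)%N by apply: leq_trans n_gt16.
have [L_gt0 leaves d_le] := span_bounds n_gt16 (hA n n_gt0).
have ln2_gt0 : 0 < ln 2 :> R by rewrite ln_gt0 // ltr1n.
have n_pos : 0 < n%:R :> R by rewrite ltr0n.
have ln_n : ln n%:R <= (depth n)%:R * ln 2 :> R.
  rewrite -mulrC mulr_natr -lnXn ?ltr0n // ler_ln ?posrE ?exprn_gt0 //.
  by rewrite -natrX ler_nat up_logP.
have max_ge0 : 0 <= Num.max (n%:R `^ w / (s n)%:R) (ln n%:R / ln 2) :> R.
  by rewrite le_max divr_ge0 ?powR_ge0 ?ler0n.
rewrite (ger0_norm max_ge0) ger0_norm ?ler0n // ler_pdivrMl // ge_max.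
apply/andP; split; last first.
  rewrite (@le_trans _ _ (depth n)%:R) ?ler_pdivrMr // -natrM ler_nat.
  by rewrite (leq_trans d_le) // leq_mul2r orbT.
have [s0|s_gt0] := posnP (s n).
  (* Division by 0 gives 0. *)
  by rewrite (_ : (s n)%:R = 0) ?s0 // invr0 mulr0 mulr_ge0.
rewrite ler_pdivrMr ?ltr0n //.
apply: (@le_trans _ _ (7 ^ depth n)%:R); last first.
  by rewrite -!natrM ler_nat -mulnA (mulnC (dag_span _)).
(* Both sides are exponentials; comparing exponents and cancelling ln 7 leaves [ln_n]. *)
rewrite natrX -powR_mulrn ?ler0n // /powR !gt_eqF ?ltr0n // ler_expR.
rewrite /w mulrAC ler_pdivrMr // mulrC [leRHS]mulrAC ler_wpM2r //.
by rewrite ln_ge0 // ler1n.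
Qed.
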